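(* Let $K$ be a field (of arbitrary characteristic) and let $\delta$ be a nonzero derivation of $K$. Then the multiplicative group $K(t;\delta)^*$ contains a free non-cyclic subgroup.
   Context: $K(t;\delta)$ denotes the quotient division ring of the differential polynomial ring $K[t;\delta]$, which is the left $K$-module $K[t]$ with multiplication determined by $ta=at+\delta(a)$ for $a\in K$. For a division ring $D$, $D^*=D\setminus\{0\}$ is its multiplicative group. *)

(* Defs.v *)
From HB Require Import structures.
From mathcomp Require Import all_boot all_order all_algebra.

Set Implicit Arguments.
Unset Strict Implicit.
Unset Printing Implicit Defensive.

Import GRing.Theory.
Local Open Scope ring_scope.

(** Derivations *)

HB.mixin Record isDerivation (R : nzRingType) (d : R -> R) := {
  derM : forall a b, d (a * b) = d a * b + a * d b
}.

#[short(type="derivation")]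
HB.structure Definition Derivation (R : nzRingType) :=
  {d of isDerivation R d & @Algebra.Additive R R d}.

Arguments derM {R} d a b : rename.

(** The differential polynomial ring K[t; delta] *)

(* Coefficients are written on the left: p stands for \sum_i p`_i t^i, so the
   additive group and the left K-module structure are those of {poly K}. *)
Definition diffpoly (K : fieldType) (delta : derivation K) : Type := {poly K}.

Section DiffPoly.
Variables (K : fieldType) (delta : derivation K).
Implicit Types (a b : K) (p q r : {poly K}).

HB.instance Definition _ := GRing.Lmodule.copy (diffpoly delta) {poly K}.

(* Left multiplication by t: t (b t^j) = b t^(j+1) + delta(b) t^j. *)
Definition tmul q : {poly K} := q * 'X + map_poly delta q.

(* (\sum_i a_i t^i) q = \sum_i a_i (t^i q). *)
Definition dmul p q : {poly K} := \sum_(i < size p) p`_i *: iter i tmul q.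

Lemma der1 : delta 1 = 0.
Proof.
have := derM delta 1 1; rewrite !mulr1 mul1r => /eqP.
by rewrite -subr_eq subrr eq_sym => /eqP.
Qed.

Fact tmul_is_zmod_morphism : zmod_morphism tmul.
Proof.
by move=> p q; rewrite /tmul mulrBl raddfB /= opprD !addrA (addrAC (p * 'X)).
Qed.
HB.instance Definition _ :=
  GRing.isZmodMorphism.Build {poly K} {poly K} tmul tmul_is_zmod_morphism.

Fact iter_tmul_is_zmod_morphism i : zmod_morphism (iter i tmul).
Proof. by elim: i => [|i IHi] p q //=; rewrite IHi raddfB. Qed.
HB.instance Definition _ i :=
  GRing.isZmodMorphism.Build {poly K} {poly K} (iter i tmul)
    (iter_tmul_is_zmod_morphism i).

Lemma tmulZ a q : tmul (a *: q) = a *: tmul q + delta a *: q.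
Proof.
apply/polyP=> i; rewrite /tmul !(coefD, coefZ, coefMX, coef_map) /= derM.
rewrite mulrDr -!addrA; congr (_ + _); last by rewrite addrC.
by case: ifP; rewrite ?mulr0.
Qed.

Lemma dmul_widen n p q :
  (size p <= n)%N -> dmul p q = \sum_(i < n) p`_i *: iter i tmul q.
Proof.
move=> le_pn; rewrite /dmul (big_ord_widen n (fun i => p`_i *: iter i tmul q)) //.
rewrite big_mkcond; apply: eq_bigr => i _; case: ltnP => // le_pi.
by rewrite nth_default ?scale0r.
Qed.

Lemma dmulDl p q r : dmul (p + q) r = dmul p r + dmul q r.
Proof.
pose n := maxn (size p) (size q).
rewrite (@dmul_widen n (p + q)) ?size_polyD //.
rewrite (@dmul_widen n p) ?leq_maxl // (@dmul_widen n q) ?leq_maxr //.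
by rewrite -big_split; apply: eq_bigr => i _; rewrite coefD scalerDl.
Qed.

Lemma dmulDr p q r : dmul p (q + r) = dmul p q + dmul p r.
Proof.
by rewrite /dmul -big_split; apply: eq_bigr => i _; rewrite raddfD scalerDr.
Qed.

Lemma dmul0p q : dmul 0 q = 0.
Proof. by rewrite /dmul size_poly0 big_ord0. Qed.

Lemma dmulZl a p q : dmul (a *: p) q = a *: dmul p q.
Proof.
rewrite (@dmul_widen (size p)) ?size_scale_leq // scaler_sumr.
by apply: eq_bigr => i _; rewrite coefZ scalerA.
Qed.

Lemma dmulXn i q : dmul 'X^i q = iter i tmul q.
Proof.
rewrite /dmul size_polyXn big_ord_recr /= big1 ?add0r => [|j _].
  by rewrite coefXn eqxx scale1r.
by rewrite coefXn ltn_eqF ?scale0r.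
Qed.

Lemma dmul_suml I (s : seq I) (F : I -> {poly K}) q :
  dmul (\sum_(i <- s) F i) q = \sum_(i <- s) dmul (F i) q.
Proof.
elim: s => [|i s IHs]; first by rewrite !big_nil dmul0p.
by rewrite !big_cons dmulDl IHs.
Qed.

Lemma tmulXn i : tmul 'X^i = 'X^(i.+1).
Proof.
rewrite /tmul -exprSr -[RHS]addr0; congr (_ + _).
apply/polyP=> j; rewrite coef_map coefXn coef0 /=.
by case: (j == i); rewrite ?der1 ?raddf0.
Qed.

Lemma dmul_tmul p q : dmul (tmul p) q = tmul (dmul p q).
Proof.
rewrite -{1}(coefK p) poly_def raddf_sum dmul_suml [in RHS]/dmul raddf_sum.
apply: eq_bigr => i _ /=.
by rewrite !tmulZ dmulDl !dmulZl tmulXn !dmulXn.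
Qed.

Fact dmulA : associative dmul.
Proof.
move=> p q r; rewrite [in LHS]/dmul [dmul p q]/dmul dmul_suml.
apply: eq_bigr => i _; rewrite dmulZl; congr (_ *: _).
by elim: (nat_of_ord i) => //= j ->; rewrite dmul_tmul.
Qed.

Fact dmul1p : left_id 1 dmul.
Proof. by move=> q; rewrite -(expr0 'X) dmulXn. Qed.

Fact dmulp1 : right_id 1 dmul.
Proof.
move=> p; rewrite -{2}(coefK p) poly_def; apply: eq_bigr => i _.
congr (_ *: _); elim: (nat_of_ord i) => [|j /= ->]; first by rewrite expr0.
by rewrite tmulXn.
Qed.

Fact dmul_distl : left_distributive dmul +%R.
Proof. by move=> p q r; apply: dmulDl. Qed.

Fact dmul_distr : right_distributive dmul +%R.
Proof. by move=> p q r; apply: dmulDr. Qed.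

HB.instance Definition _ := GRing.Zmodule_isNzRing.Build (diffpoly delta)
  dmulA dmul1p dmulp1 dmul_distl dmul_distr (oner_neq0 {poly K}).

Definition diffC a : diffpoly delta := a%:P.
Definition diffX : diffpoly delta := 'X.

Lemma mul_diffC a (p : diffpoly delta) : diffC a * p = a *: p.
Proof.
by rewrite [LHS](_ : _ = dmul a%:P p) // -alg_polyC dmulZl dmul1p.
Qed.

Lemma diffX_comm a : diffX * diffC a = diffC a * diffX + diffC (delta a).
Proof.
rewrite [LHS](_ : _ = tmul a%:P); last exact: (dmulXn 1 a%:P).
by rewrite mul_diffC /tmul mul_polyC map_polyC.
Qed.

Lemma diffpolyE (p : diffpoly delta) :
  p = \sum_(i < size (p : {poly K})) diffC (p : {poly K})`_i * diffX ^+ i.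
Proof.
have dX i : diffX ^+ i = 'X^i :> {poly K}.
  elim: i => [|i IHi]; first by rewrite !expr0.
  by rewrite exprS -tmulXn -IHi [LHS](dmulXn 1).
rewrite -{1}(coefK p) poly_def; apply: eq_bigr => i _.
by rewrite mul_diffC dX.
Qed.

End DiffPoly.

(** Division rings and their multiplicative groups *)

HB.mixin Record UnitRing_isDivisionRing D of GRing.UnitRing D := {
  divring_unit : forall x : D, x != 0 -> x \is a GRing.unit
}.

#[short(type="divisionRingType")]
HB.structure Definition DivisionRing :=
  {D of UnitRing_isDivisionRing D & GRing.UnitRing D}.

Definition nonzero (D : divisionRingType) : Type := {x : D | x != 0}.

Section NonzeroGroup.
Variable D : divisionRingType.

HB.instance Definition _ := SubChoice.on (nonzero D).

Fact mul_nonzero (x y : nonzero D) : val x * val y != 0.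
Proof.
have Ux := divring_unit _ (valP x); apply: contraNneq (valP y) => xy0.
by rewrite -(mulKr Ux (val y)) xy0 mulr0.
Qed.

Fact inv_nonzero (x : nonzero D) : (val x)^-1 != 0.
Proof. by rewrite invr_eq0; exact: (valP x). Qed.

Definition nz_one : nonzero D := Sub 1 (oner_neq0 D).
Definition nz_mul (x y : nonzero D) : nonzero D := Sub (val x * val y) (mul_nonzero x y).
Definition nz_inv (x : nonzero D) : nonzero D := Sub (val x)^-1 (inv_nonzero x).

Fact nz_mulA : associative nz_mul.
Proof. by move=> x y z; apply/val_inj/mulrA. Qed.
Fact nz_mul1 : left_id nz_one nz_mul.
Proof. by move=> x; apply/val_inj/mul1r. Qed.
Fact nz_mulr1 : right_id nz_one nz_mul.
Proof. by move=> x; apply/val_inj/mulr1. Qed.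
Fact nz_mulV : left_inverse nz_one nz_inv nz_mul.
Proof. by move=> x; exact/val_inj/mulVr/divring_unit/(valP x). Qed.
Fact nz_mulrV : right_inverse nz_one nz_inv nz_mul.
Proof. by move=> x; exact/val_inj/mulrV/divring_unit/(valP x). Qed.

HB.instance Definition _ := isGroup.Build (nonzero D)
  nz_mulA nz_mul1 nz_mulr1 nz_mulV nz_mulrV.

End NonzeroGroup.

(* Injectivity of f and the existence of fractions characterize the Ore
   quotient division ring of R up to a unique isomorphism over R; they force R
   to be a right Ore domain. *)
Definition is_quotient_division_ring (R : nzRingType) (D : divisionRingType)
    (f : {rmorphism R -> D}) : Prop :=
  injective f /\ forall x : D, exists a s : R, s != 0 /\ x = f a / f s.

(** Free subgroups of a group *)

Section FreeSubgroup.
Variable G : groupType.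
Local Open Scope group_scope.
Implicit Types (X H : G -> Prop) (w : seq (G * bool)).

Definition is_subgroup H : Prop :=
  [/\ H 1, forall x y, H x -> H y -> H (x * y) & forall x, H x -> H x^-1].

(* The letter (x, false) stands for x and (x, true) for its formal inverse. *)
Definition letter_val (l : G * bool) : G := if l.2 then l.1^-1 else l.1.

Definition word_val w : G := \prod_(l <- w) letter_val l.

Definition word_over X w : Prop := forall l, l \in w -> X l.1.

Definition reduced w : bool :=
  sorted (fun l m => ~~ ((l.1 == m.1) && (l.2 != m.2))) w.

Definition is_generated_by X H : Prop :=
  forall h, H h <-> exists2 w, word_over X w & h = word_val w.

Definition is_free_basis X H : Prop :=
  is_generated_by X H /\
  (forall w, word_over X w -> reduced w -> word_val w = 1 -> w = [::]).

Definition is_free H : Prop := exists X, is_free_basis X H.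

Definition is_cyclic H : Prop :=
  exists g, forall h, H h <-> exists n : nat, h = g ^+ n \/ h = g ^- n.

End FreeSubgroup.

(* Main.v *)
Require Import Defs.
From HB Require Import structures.
From mathcomp Require Import all_boot all_order all_algebra.
From mathcomp Require Import ring zify.
From Stdlib Require Import Classical_Prop.

(** Choose x in K with delta x <> 0. In K[t;delta] the elements T = x and
Y = - (x / delta x) t satisfy T Y = (Y + 1) T, and they satisfy no further
relation over the prime ring of K, because x is transcendental over it. Let p be
the characteristic of K, or 2 if that characteristic is 0; the ring generated by
Y and T then acts on F_p[z][X] by Y = z - X d/dX and T = X. The elements of
F_p[z, X^p] act as scalars and N = prod_a (z - a) is one of them.

Let g = Y (Y - 1)^-1 and h = U g U^-1 with U a polynomial in T. Up to the factor
N, both g and g^-1 act as operators which at z = 0 become nonzero multiples of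
the projections onto the monomials X^i with i = -1, resp. i = 0, modulo p, and
U is chosen so that multiplication by U or by U^-1 mixes these two classes. Hence
a nonempty reduced word in g and h acts as N^-m phi with phi nonzero at z = 0 and
m > 0, so it is not 1.

Denominators cause the only difficulty when K has characteristic 0, as the
scalars above are then central only modulo p; explicit Ore conditions for the
factors Y - c and U allow one to move them to the right. *)

Set Implicit Arguments.
Unset Strict Implicit.
Unset Printing Implicit Defensive.

Import GRing.Theory.
Local Open Scope ring_scope.

(* Noncommutative polynomial expressions in Y and T, to be evaluated both in a
   division ring and, modulo p, as operators. *)
Inductive wexpr :=
  | WY | WT | WC of int | WAdd of wexpr & wexpr | WMul of wexpr & wexpr.

Fixpoint weval (A : nzRingType) (y t : A) (e : wexpr) : A :=
  match e with
  | WY => y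
  | WT => t
  | WC c => c%:~R
  | WAdd a b => weval y t a + weval y t b
  | WMul a b => weval y t a * weval y t b
  end.

(* With z and X the inner and outer variables of {poly {poly k}}, Y acts as
   z - X d/dX. This is the left regular representation of the ring generated by
   Y and T, with X^i z^j standing for T^i Y^j. *)
Fixpoint wact (k : comNzRingType) (e : wexpr) (v : {poly {poly k}}) :=
  match e with
  | WY => 'X%:P * v - 'X * v^`()
  | WT => 'X * v
  | WC c => v *~ c
  | WAdd a b => wact a v + wact b v
  | WMul a b => wact a (wact b v)
  end.

(* In characteristic p the scalars s are the polynomials in z and X^p. *)
Lemma wactZ (k : comNzRingType) e (s v : {poly {poly k}}) :
  s^`() = 0 -> wact e (s * v) = s * wact e v.
Proof.
move=> s0; elim: e v => [||c|a IHa b IHb|a IHa b IHb] v /=.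
- by rewrite derivM s0; ring.
- by ring.
- by rewrite mulrzAr.
- by rewrite IHa IHb; ring.
- by rewrite IHb IHa.
Qed.

Definition wred (k : comNzRingType) : {poly {poly int}} -> {poly {poly k}} :=
  map_poly (map_poly intr).

Lemma wact_red (k : comNzRingType) e (v : {poly {poly int}}) :
  wred k (wact e v) = wact e (wred k v).
Proof.
rewrite /wred; elim: e v => [||c|a IHa b IHb|a IHa b IHb] v /=.
- by rewrite rmorphB !rmorphM /= map_polyC /= !map_polyX deriv_map.
- by rewrite rmorphM /= map_polyX.
- by rewrite rmorphMz.
- by rewrite rmorphD /= IHa IHb.
- by rewrite IHa IHb.
Qed.

Lemma wred_surj p (w : {poly {poly 'F_p}}) : exists v, wred 'F_p v = w.
Proof.
pose lift (a : 'F_p) : int := Posz (val a).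
have lift0 : lift 0 = 0 by [].
have mlift0 : map_poly lift 0 = 0 by rewrite map_poly0.
exists (map_poly (map_poly lift) w).
apply/polyP=> i; apply/polyP=> j; rewrite !coef_map /= coef_map_id0 //.
by rewrite coef_map_id0 // /lift /= -[LHS]/((val w`_i`_j)%:R) natr_Zp.
Qed.

(** * Integral normal forms in T^i Y^j *)

Section Theta.
Variables (A : nzRingType) (y t : A).
Hypothesis ty : t * y = (y + 1) * t.

Definition wtheta1 (q : {poly int}) : A := (map_poly intr q).[y].
Definition wtheta (v : {poly {poly int}}) : A :=
  \sum_(i < size v) t ^+ i * wtheta1 v`_i.

Lemma wtheta1_zmod : zmod_morphism wtheta1.
Proof. by move=> p q; rewrite /wtheta1 rmorphB /= hornerD hornerN. Qed.
HB.instance Definition _ :=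
  GRing.isZmodMorphism.Build {poly int} A wtheta1 wtheta1_zmod.

Lemma wtheta1X q : wtheta1 ('X * q) = y * wtheta1 q.
Proof.
rewrite /wtheta1 mulrC rmorphM /= map_polyX hornerMX.
have : GRing.comm (map_poly intr q).[y] y; last by [].
rewrite horner_coef; apply: commr_sym; apply: commr_sum => i _.
by apply: commrM; [rewrite coef_map /=; apply: commr_int | apply: commrX].
Qed.

Lemma wtheta_widen n (v : {poly {poly int}}) :
  (size v <= n)%N -> wtheta v = \sum_(i < n) t ^+ i * wtheta1 v`_i.
Proof.
move=> le_vn; rewrite /wtheta (big_ord_widen n (fun i => t ^+ i * wtheta1 v`_i)) //.
rewrite big_mkcond; apply: eq_bigr => i _; case: ltnP => // le_vi.
by rewrite nth_default ?raddf0 ?mulr0.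
Qed.

Lemma wtheta_zmod : zmod_morphism wtheta.
Proof.
move=> u v; pose n := maxn (size u) (size v).
have le_n : (size (u - v)%R <= n)%N.
  by rewrite (leq_trans (size_polyD _ _)) // size_polyN.
rewrite (wtheta_widen le_n) (@wtheta_widen n u) ?leq_maxl //.
rewrite (@wtheta_widen n v) ?leq_maxr // -sumrB.
by apply: eq_bigr => i _; rewrite coefB raddfB mulrBr.
Qed.
HB.instance Definition _ :=
  GRing.isZmodMorphism.Build {poly {poly int}} A wtheta wtheta_zmod.

Lemma wyt n : y * t ^+ n = t ^+ n * (y - n%:R).
Proof.
elim: n => [|n IHn]; first by rewrite expr0 subr0 mulr1 mul1r.
have yt : y * t = t * (y - 1).
  by rewrite mulrBr ty mulrDl mul1r mulr1 addrK.
rewrite exprS mulrA yt -mulrA mulrBl IHn mul1r -mulrA; congr (t * _).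
by rewrite -{2}[t ^+ n]mulr1 -mulrBr -natr1 opprD addrA.
Qed.

(** Normal form is restored by Y T^i = T^i (Y - i), which is the rule z - X d/dX by which [WY]
    acts. *)
Lemma wthetaE e (v : {poly {poly int}}) : wtheta (wact e v) = weval y t e * wtheta v.
Proof.
elim: e v => [||c|a IHa b IHb|a IHa b IHb] v /=.
- set w := (X in wtheta X).
  have wE i : w`_i = ('X - i%:R) * v`_i.
    rewrite coefB coefCM coefXM; case: i => [|i]; first by rewrite !subr0.
    by rewrite coef_deriv /= mulrBl mulr_natl.
  rewrite (@wtheta_widen (size v)) /wtheta.
    rewrite mulr_sumr; apply: eq_bigr => i _.
    rewrite wE mulrBl raddfB /= wtheta1X mulr_natl raddfMn /=.
    by rewrite mulrA wyt -mulrA mulrBl mulr_natl.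
  by apply/leq_sizeP => j le_vj; rewrite wE nth_default ?mulr0.
- rewrite (@wtheta_widen (size v).+1).
    rewrite big_ord_recl coefXM eqxx raddf0 mulr0 add0r /wtheta mulr_sumr.
    by apply: eq_bigr => i _; rewrite coefXM /= exprS -mulrA.
  by rewrite (leq_trans (size_polyMleq _ _)) // size_polyX.
- by rewrite raddfMz -mulrzl.
- by rewrite raddfD /= IHa IHb mulrDl.
- by rewrite IHa IHb mulrA.
Qed.

End Theta.

(** * Transcendence over the prime ring by means of a derivation *)

Lemma der_intr (K : fieldType) (delta : derivation K) (c : int) :
  delta c%:~R = 0.
Proof. by rewrite raddfMz /= der1 mul0rz. Qed.

Lemma der_horner_int (K : fieldType) (delta : derivation K) x (P : {poly int}) :
  delta (map_poly intr P).[x] = (map_poly intr P^`()).[x] * delta x.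
Proof.
elim/poly_ind: P => [|P c IHP]; first by rewrite deriv0 map_poly0 horner0 raddf0 mul0r.
rewrite derivD derivC addr0 derivM derivX mulr1 !rmorphD !rmorphM /=.
rewrite map_polyX map_polyC /= !hornerE raddfD /= derM IHP der_intr.
by ring.
Qed.

(** Strong induction on [size P]: differentiating the relation gives P'(x) = 0, hence P' = 0 in
    K[X]. Then either P is constant over K, or K has characteristic p and P = Q(X^p); Frobenius
    fixes integers, so Q(x)^p = P(x) = 0 with Q smaller than P. *)
Lemma int_poly_transcendental (K : fieldType) (delta : derivation K) x :
  delta x != 0 -> forall P : {poly int}, (map_poly intr P).[x] = 0 ->
  map_poly intr P = 0 :> {poly K}.
Proof.
move=> dx0 P; have [n] := ubnP (size P); elim: n P => // n IHn P le_Pn Px0.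
have [->|P0] := eqVneq P 0; first by rewrite map_poly0.
have P'0 : map_poly intr P^`() = 0 :> {poly K}.
  apply: IHn; first exact: leq_trans (lt_size_deriv P0) _.
  by apply: (mulIf dx0); rewrite -der_horner_int Px0 raddf0 mul0r.
have cP i : (P`_i)%:~R *+ i = 0 :> K.
  case: i => [|i]; first exact: mulr0n.
  by have /polyP/(_ i) := P'0; rewrite coef_map coef_deriv coef0 /= rmorphMn.
have [/allP cst|] := boolP (all (fun i => (P`_i.+1)%:~R == 0 :> K) (iota 0 (size P))).
  have defP : map_poly intr P = (P`_0)%:~R%:P :> {poly K}.
    apply/polyP=> -[|i]; rewrite coef_map coefC //=.
    have [lt_i|le_i] := ltnP i (size P).
      by apply/eqP/cst; rewrite mem_iota.
    by rewrite nth_default // ltnW.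
  by move: Px0; rewrite defP hornerC => ->.
rewrite -has_predC => /hasP[i _ /= Pi0].
have := cP i.+1; rewrite -mulr_natr => /eqP; rewrite mulf_eq0 (negPf Pi0) /=.
case/natf0_pchar => // p pK.
have p_gt1 := prime_gt1 (pcharf_prime pK).
have dvdP j : (P`_j)%:~R != 0 :> K -> (p %| j)%N.
  move=> Pj0; have := cP j; rewrite -mulr_natr => /eqP.
  by rewrite mulf_eq0 (negPf Pj0) /= (dvdn_pcharf pK).
have sP : (1 < size P)%N.
  apply: (@leq_ltn_trans i.+1) => //; rewrite ltnNge; apply: contra Pi0 => le_i.
  by rewrite nth_default.
pose Q := \poly_(j < size P) P`_(j * p).
have defP : map_poly intr P = (map_poly intr Q) \Po 'X^p :> {poly K}.
  apply/polyP=> j; rewrite coef_comp_poly_Xn ?(ltnW p_gt1) // coef_map /=.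
  case: ifP => [/dvdnP[k ->]|/negP ndv].
    rewrite mulnK ?(ltnW p_gt1) // coef_map coef_poly /=.
    have [//|le_k] := ltnP k (size P).
    by rewrite nth_default // (leq_trans le_k) // leq_pmulr // ltnW.
  by apply/eqP/negPn/negP => /dvdP.
have Qx0 : (map_poly intr Q).[x] = 0 :> K.
  have : (map_poly intr Q).[x] ^+ p = 0 :> K.
    rewrite -(pFrobenius_autE pK) -horner_map -map_poly_comp /= pFrobenius_autE.
    rewrite -Px0 defP horner_comp hornerXn; congr (_.[_]).
    by apply: eq_map_poly => c /=; rewrite pFrobenius_aut_int.
  by move/eqP; rewrite expf_eq0 => /andP[_ /eqP].
rewrite defP IHn ?comp_poly0 //; apply: (@leq_ltn_trans (size P).-1); last by lia.
(* As [size P] is at least 2, j >= [(size P).-1] implies j * p >= 2 j >= [size P]. *)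
apply/leq_sizeP => j le_j; rewrite coef_poly; case: ifP => // _.
rewrite nth_default //; apply: leq_trans (leq_mul (leqnn j) p_gt1).
by case: (size P) sP le_j => [|[|s]] // _ /= le_sj; lia.
Qed.

(** * The elements T and Y of K[t; delta] *)

Section Weyl.
Variables (K : fieldType) (delta : derivation K) (x : K).
Hypothesis dx0 : delta x != 0.

Definition weylT : diffpoly delta := diffC delta x.
Definition weylY : diffpoly delta := diffC delta (- (x / delta x)) * diffX delta.

Lemma weyl_comm : weylT * weylY = (weylY + 1) * weylT.
Proof.
have diffCM a b : diffC delta a * diffC delta b = diffC delta (a * b).
  by rewrite mul_diffC /diffC -mul_polyC -polyCM.
have diffC1 : 1 = diffC delta 1 by [].
have diffCD a b : diffC delta a + diffC delta b = diffC delta (a + b).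
  by rewrite /diffC -polyCD.
rewrite /weylT /weylY mulrDl mul1r -[in RHS]mulrA diffX_comm mulrDr.
rewrite [in RHS]mulrA [in LHS]mulrA !diffCM -addrA diffCD [x * _]mulrC.
rewrite [_ * delta x]mulNr divfK // addNr.
by rewrite [X in _ + X](_ : _ = 0) ?addr0 // /diffC polyC0.
Qed.

Lemma weylY_mul (q : diffpoly delta) :
  weylY * q = (- (x / delta x)) *: tmul delta q :> {poly K}.
Proof.
by rewrite /weylY -mulrA mul_diffC [diffX delta * q](dmulXn delta 1 q).
Qed.

Lemma weylYX j : let q : {poly K} := weylY ^+ j in
  (size q <= j.+1)%N /\ q`_j = (- (x / delta x)) ^+ j.
Proof.
elim: j => [|j [szq qj]] /=.
  by rewrite !expr0 size_poly1 coef1 eqxx.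
set q : {poly K} := weylY ^+ j in szq qj.
have tq i : (tmul delta q)`_i.+1 = q`_i + delta q`_i.+1.
  by rewrite coefD coefMX /= coef_map.
rewrite exprS weylY_mul; split.
  apply/leq_sizeP => -[|i] // le_ji; rewrite coefZ tq.
  by rewrite !(nth_default 0 (s := q)) ?raddf0 ?addr0 ?mulr0 // (leq_trans szq) // ltnW.
by rewrite coefZ tq qj (nth_default 0 (s := q)) // raddf0 addr0 exprS.
Qed.

Lemma weylY_free m (a : nat -> K) :
  x != 0 ->
  \sum_(j < m) a j *: (weylY ^+ j : {poly K}) = 0 -> forall j, (j < m)%N -> a j = 0.
Proof.
move=> x0; have l0 j : (- (x / delta x)) ^+ j != 0.
  by rewrite expf_neq0 // oppr_eq0 mulf_neq0 ?invr_eq0.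
elim: m => [//|m IHm]; rewrite big_ord_recr /= => sum0.
have am0 : a m = 0.
  have /polyP/(_ m) := sum0; rewrite coefD coefZ coef0 coef_sum big1 ?add0r.
    by have [_ ->] := weylYX m; move/eqP; rewrite mulf_eq0 (negPf (l0 m)) orbF => /eqP.
  move=> j _; have [szj _] := weylYX j.
  by rewrite coefZ nth_default ?mulr0 // (leq_trans szj).
move: sum0; rewrite am0 scale0r addr0 => /IHm aj j.
by rewrite ltnS leq_eqVlt => /predU1P[-> // | /aj].
Qed.

(** Grouping by powers of Y gives coefficients P_j(x). They vanish because Y^j has degree j in t,
    and then P_j vanishes over K because x is transcendental over the prime ring. *)
Lemma wtheta_weyl_inj (v : {poly {poly int}}) :
  wtheta weylY weylT v = 0 -> forall i j, (v`_i`_j)%:~R = 0 :> K.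
Proof.
have x0 : x != 0 by apply: contraNneq dx0 => ->; rewrite raddf0.
move=> v0 i j.
pose m := (\max_(k < size v) size (v`_k)%R)%N.
have szm k : (size (v`_k)%R <= m)%N.
  have [lt_k|le_k] := ltnP k (size v); last by rewrite nth_default ?size_poly0.
  exact: (leq_bigmax (Ordinal lt_k)).
pose P j : {poly int} := \poly_(k < size v) v`_k`_j.
have PE k l : (P k)`_l = v`_l`_k.
  rewrite coef_poly; case: ltnP => // le_l.
  by rewrite [v`_l]nth_default ?coef0.
have Tk k (q : diffpoly delta) : weylT ^+ k * q = x ^+ k *: q.
  elim: k => [|k IHk]; first by rewrite !expr0 mul1r scale1r.
  by rewrite exprS -mulrA IHk mul_diffC scalerA -exprS.
have Yint k (c : int) : c%:~R * weylY ^+ k = c%:~R *: weylY ^+ k.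
  by rewrite mulrzl -scaler_int.
have th1 (q : {poly int}) : (size q <= m)%N ->
  wtheta1 weylY q = \sum_(k < m) (q`_k)%:~R *: weylY ^+ k.
  move=> le_qm; rewrite /wtheta1 (@horner_coef_wide _ m) //.
    by apply: eq_bigr => k _; rewrite coef_map Yint.
  by apply: leq_trans le_qm; apply: size_poly.
have thE : wtheta weylY weylT v =
    \sum_(k < m) (map_poly intr (P k)).[x] *: weylY ^+ k.
  rewrite /wtheta.
  under eq_bigr => k _ do rewrite Tk th1 // scaler_sumr.
  rewrite exchange_big; apply: eq_bigr => k _ /=.
  rewrite (@horner_coef_wide _ (size v)) ?scaler_suml.
    apply: eq_bigr => l _; rewrite coef_map /= PE scalerA mulrC //.
  by apply: (leq_trans (size_poly _ _)); apply: size_poly.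
have [lt_jm|le_mj] := ltnP j m; last first.
  by rewrite nth_default // (leq_trans (szm i)).
have Pj0 : (map_poly intr (P j)).[x] = 0.
  by apply: (@weylY_free m (fun k => (map_poly intr (P k)).[x])); rewrite -?thE.
have /polyP/(_ i) := int_poly_transcendental dx0 Pj0.
by rewrite coef_map coef0 /= PE.
Qed.

End Weyl.

(** * From the prime ring of K to F_p *)

Definition prime_reduction (K : fieldType) (p : nat) :=
  forall c : int, c%:~R = 0 :> K -> c%:~R = 0 :> 'F_p.

Lemma prime_reduction_ex (K : fieldType) : exists2 p, prime p & prime_reduction K p.
Proof.
have int0 (k : nzRingType) (c : int) : (c%:~R == 0 :> k) = (`|c|%:R == 0 :> k).
  by rewrite {1}[c]intEsign; case: (c < 0)%R; rewrite ?mul1r ?mulN1r ?mulrNz ?oppr_eq0 -pmulrn.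
(* Without a positive characteristic, 0 is the only integer vanishing in K and any prime works; the
   case split needs excluded middle. *)
case: (classic (exists p, p \in [pchar K])) => [[p pK]|nop].
  have pP := pcharf_prime pK; exists p => // c /eqP; rewrite int0 => c0.
  by apply/eqP; rewrite int0 -(dvdn_pcharf (pchar_Fp pP)) (dvdn_pcharf pK).
exists 2 => // c /eqP; rewrite int0; have [/eqP|] := eqVneq `|c|%N 0%N.
  by rewrite absz_eq0 => /eqP ->.
by rewrite -lt0n => c0 /(natf0_pchar c0) [p pK]; case: nop; exists p.
Qed.

(** Lift w to an integral v. If e1 and e2 agree in D, [wtheta] kills the difference of their actions
    on v, whose coefficients are therefore 0 in K and so modulo p. *)
Lemma wact_faithful (K : fieldType) (delta : derivation K) x p
    (D : nzRingType) (f : {rmorphism diffpoly delta -> D}) (e1 e2 : wexpr) :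
  delta x != 0 -> injective f -> prime_reduction K p ->
  let ev := weval (f (weylY delta x)) (f (weylT delta x)) in
  ev e1 = ev e2 -> @wact 'F_p e1 =1 wact e2.
Proof.
move=> dx0 f_inj redp ev.
have evf e : ev e = f (weval (weylY delta x) (weylT delta x) e).
  elim: e => //= [c|a IHa b IHb|a IHa b IHb]; first by rewrite rmorph_int.
    by rewrite rmorphD -IHa -IHb.
  by rewrite rmorphM -IHa -IHb.
rewrite !evf => /f_inj ev12 w; have [v <-] := wred_surj w.
have van := wtheta_weyl_inj dx0 (v := wact e1 v - wact e2 v).
rewrite -!wact_red; apply/eqP; rewrite -subr_eq0; apply/eqP.
apply/polyP=> i; apply/polyP=> j; rewrite -[LHS]/((wred _ _ - wred _ _)`_i`_j).
rewrite coefB coefB !coef_map /= -rmorphB !coef0; apply: redp.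
rewrite -!coefB; apply: van.
by rewrite raddfB /= !wthetaE ?ev12 ?subrr //; exact: weyl_comm.
Qed.

(** * Right Ore conditions with explicit witnesses *)

Definition wlin (c : int) := WAdd WY (WC (- c)).
Definition wexp e n := iter n (WMul e) (WC 1).
Definition wprod (s : seq int) := foldr (fun c e => WMul (wlin c) e) (WC 1) s.

Section Ore.
Variables (D : nzRingType) (y t : D).
Hypothesis ty : t * y = (y + 1) * t.
Local Notation ev := (weval y t).

Lemma weval_wexp e n : ev (wexp e n) = ev e ^+ n.
Proof. by elim: n => [|n IHn] //=; rewrite IHn exprS. Qed.

(** For invertible values this turns n^-1 e into d c^-1; the witnesses are expressions so that they
    can also be read modulo p. *)
Definition ore_set (S : wexpr -> Prop) := forall e n, S n ->
  exists c d, S c /\ ev e * ev c = ev n * ev d.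

(** Induction on e. A sum uses the common denominator ca cb, whose factors may be swapped; a product
    treats its two factors in turn. *)
Lemma ore_set_gen (S : wexpr -> Prop) :
    (forall a b, S a -> S b -> S (WMul a b)) ->
    (forall a b, S a -> S b -> GRing.comm (ev a) (ev b)) ->
    (forall n, S n -> exists c d, S c /\ y * ev c = ev n * ev d) ->
    (forall n, S n -> exists c d, S c /\ t * ev c = ev n * ev d) ->
  ore_set S.
Proof.
move=> SM Scomm SY ST; elim=> [||c|a IHa b IHb|a IHa b IHb] n Sn //=.
- exact: SY.
- exact: ST.
- by exists n, (WC c); split=> //=; apply: commr_sym; apply: commr_int.
- have [ca [da [Sca defa]]] := IHa n Sn; have [cb [db [Scb defb]]] := IHb n Sn.
  exists (WMul ca cb), (WAdd (WMul da cb) (WMul db ca)); split; first exact: SM.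
  rewrite /= mulrDl mulrA defa (Scomm ca cb) // mulrA defb mulrDr.
  by rewrite !mulrA.
- have [ca [da [Sca defa]]] := IHa n Sn; have [cb [db [Scb defb]]] := IHb ca Sca.
  exists cb, (WMul da db); split=> //=.
  by rewrite -mulrA defb mulrA defa mulrA.
Qed.

Inductive linear_product : wexpr -> Prop :=
  | LP1 : linear_product (WC 1)
  | LPlin c : linear_product (wlin c)
  | LPM a b : linear_product a -> linear_product b -> linear_product (WMul a b).

Lemma linear_product_comm (z : D) n :
  GRing.comm z y -> linear_product n -> GRing.comm z (ev n).
Proof.
move=> zy; elim=> /= [|c|a b _ IHa _ IHb].
- exact: commr1.
- by apply: commrD => //; apply: commr_int.
- exact: commrM.
Qed.

Lemma ore_linear_product : ore_set linear_product.
Proof.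
have commy n : linear_product n -> GRing.comm y (ev n).
  by move=> Sn; apply: linear_product_comm.
apply: ore_set_gen => [||n Sn|n Sn].
- exact: LPM.
- move=> a b Sa Sb; apply: linear_product_comm => //.
  exact/commr_sym/commy.
- by exists n, WY; split=> //=; apply: commy.
- suff [c [Sc tc]] : exists c, linear_product c /\ t * ev c = ev n * t.
    (* The induction rests on T (Y - (c + 1)) = (Y - c) T: crossing T shifts the root. *)
    by exists c, WT.
  elim: Sn => /= [|c|a b _ [ca [Sca tca]] _ [cb [Scb tcb]]].
  + by exists (WC 1); split; [exact: LP1 | rewrite /= mul1r mulr1].
  + exists (wlin (c + 1)); split; first exact: LPlin.
    rewrite /= mulrDr ty [LHS]/= opprD intrD mulrDr mulrN1z mulrN1 !mulrDl mul1r.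
    by rewrite (commr_int t) -!addrA; congr (_ + _); rewrite addrC addrNK.
  + exists (WMul ca cb); split; first exact: LPM.
    by rewrite /= mulrA tca -!mulrA tcb.
Qed.

Variable u : wexpr.
Hypothesis ut : GRing.comm (ev u) t.
Hypothesis uyt : GRing.comm (y * ev u - ev u * y) t.
Hypothesis ucent : forall z : D, GRing.comm z t -> GRing.comm z (ev u).

Inductive power_of : wexpr -> Prop :=
  | PO1 : power_of (WC 1)
  | POu : power_of u
  | POM a b : power_of a -> power_of b -> power_of (WMul a b).

Lemma ore_power_of : ore_set power_of.
Proof.
have tcomm n : power_of n -> GRing.comm (ev n) t.
  elim=> //= [|a b _ IHa _ IHb]; first exact/commr_sym/commr1.
  by apply/commr_sym/commrM; apply: commr_sym.
have cent z n : GRing.comm z t -> power_of n -> GRing.comm z (ev n).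
  by move=> zt; elim=> [||a b _ IHa _ IHb]; [exact: commr1|exact: ucent|exact: commrM].
have bracket n : power_of n -> GRing.comm (y * ev n - ev n * y) t.
  elim=> //= [|a b Sa IHa Sb IHb].
    by rewrite mul1r mulr1 subrr; apply/commr_sym/commr0.
  have -> : y * (ev a * ev b) - ev a * ev b * y =
      (y * ev a - ev a * y) * ev b + ev a * (y * ev b - ev b * y).
    by rewrite mulrBl mulrBr !mulrA addrA subrK.
  by apply/commr_sym/commrD; apply/commrM; apply: commr_sym; do ?exact: tcomm.
apply: ore_set_gen => [||n Sn|n Sn].
- exact: POM.
- by move=> a b Sa Sb; apply: cent => //; apply: tcomm.
(* With b = y n - n y, which commutes with n, one has y n^2 = n (y n + b). *)
- exists (WMul n n), (WAdd (WMul WY n) (WAdd (WMul WY n) (WMul (WC (-1)) (WMul n WY)))).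
  split; first exact: POM.
  rewrite /= mulN1r.
  have := cent _ _ (bracket n Sn) Sn; rewrite /GRing.comm => bn.
  rewrite mulrDr -bn mulrBl !mulrA addrC subrK //.
- by exists n, WT; split=> //=; apply/commr_sym/tcomm.
Qed.

End Ore.

(** * Scalars and inverses modulo p *)

Section ModP.
Variable p : nat.
Hypothesis p_pr : prime p.
Local Notation F := 'F_p.
Local Notation M := {poly {poly 'F_p}}.
Local Notation act := (@wact 'F_p).

Let pF : p \in [pchar F] := pchar_Fp p_pr.

Lemma natF_eq0 n : (n%:R == 0 :> F) = (p %| n)%N.
Proof. by rewrite (dvdn_pcharf pF). Qed.

Definition norm_poly : {poly F} := \prod_(a : F) ('X - a%:P).

Lemma coef_wlin c (v : M) j :
  (act (wlin c) v)`_j = ('X - (j%:R + c%:~R)%:P) * v`_j.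
Proof.
rewrite /= mulrNz -mulrzl coefD coefB coefN coefCM coefXM.
rewrite -(rmorph_int (polyC \o polyC)) /= coefCM polyCD opprD addrA !mulrDl !mulNr.
congr (_ + _); congr (_ - _).
case: j => [|j]; first by rewrite polyC0 mul0r.
by rewrite coef_deriv /= polyC_natr mulr_natl.
Qed.

Lemma coef_wprod s (v : M) j :
  (act (wprod s) v)`_j = (\prod_(c <- s) ('X - (j%:R + c%:~R)%:P)) * v`_j.
Proof.
elim: s => [|c s IHs]; first by rewrite big_nil mul1r.
by rewrite big_cons -mulrA -IHs -coef_wlin.
Qed.

Definition others (c : int) : seq int := [seq Posz (val a) | a <- enum F & a != c%:~R].

Lemma prod_others c (f : F -> {poly F}) :
  \prod_(b <- others c) f b%:~R = \prod_(a | a != c%:~R) f a.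
Proof.
rewrite /others big_map big_filter big_enum_cond /=; apply: eq_bigr => a _.
by rewrite -pmulrn natr_Zp.
Qed.

(** Both factors are diagonal on the X^j. As a runs over F_p so does j + a, hence the product of the
    eigenvalues z - (j + a) is N for every j. *)
Lemma act_others_lin c (v : M) :
  act (wprod (others c)) (act (wlin c) v) = norm_poly%:P * v.
Proof.
apply/polyP=> j; rewrite coef_wprod coef_wlin coefCM mulrA; congr (_ * _).
rewrite (prod_others _ (fun a => 'X - (j%:R + a)%:P)) mulrC.
rewrite /norm_poly [RHS](reindex_inj (addrI (j%:R : F))) /=.
by rewrite [RHS](bigD1 (c%:~R : F)).
Qed.

Lemma act_lin_others c (v : M) :
  act (wlin c) (act (wprod (others c)) v) = norm_poly%:P * v.
Proof.
rewrite -(act_others_lin c); apply/polyP=> j.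
by rewrite !(coef_wlin, coef_wprod) mulrCA.
Qed.

Lemma norm_poly_neq0 : norm_poly != 0.
Proof. by apply/prodf_neq0 => a _; rewrite polyXsubC_eq0. Qed.

Lemma norm_poly0 : norm_poly.[0] = 0.
Proof.
by rewrite horner_prod (bigD1 0) //= hornerXsubC subrr mul0r.
Qed.

(** A right inverse up to a nonzero scalar suffices to cancel a denominator; c' need not come from
    an expression. *)
Definition quasi_unit (c : wexpr) := exists (c' : M -> M) (k : M),
  [/\ k^`() = 0, k != 0 & forall v, act c (c' v) = k * v].

Lemma quasi_unit1 : quasi_unit (WC 1).
Proof.
by exists id, 1; split; rewrite ?derivC ?oner_neq0 // => v; rewrite mul1r.
Qed.

Lemma quasi_unitM a b : quasi_unit a -> quasi_unit b -> quasi_unit (WMul a b).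
Proof.
move=> [a' [k [dk k0 aa']]] [b' [l [dl l0 bb']]].
exists (b' \o a'), (l * k); split=> [||v /=]; last by rewrite bb' wactZ // aa' mulrA.
  by rewrite derivM dk dl mul0r mulr0 addr0.
by rewrite mulf_neq0.
Qed.

Lemma quasi_unit_linear_product n : linear_product n -> quasi_unit n.
Proof.
elim=> [|c|a b _ IHa _ IHb]; [exact: quasi_unit1 | | exact: quasi_unitM].
exists (act (wprod (others c))), norm_poly%:P; split; first exact: derivC.
  by rewrite polyC_eq0 norm_poly_neq0.
exact: act_lin_others.
Qed.

Definition wU := WAdd (WC 1) (WAdd WT (wexp WT (2 * p).-1)).
(* The exponent 2p - 1 is -1 modulo p, and it is at least p, so that below degree
   p the power upoly ^+ p.-1 has the coefficients of (1 + 'X) ^+ p.-1. *)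
Definition upoly (k : nzRingType) : {poly k} := 1 + 'X + 'X^((2 * p).-1).

Lemma act_wexp e (m : M) n v : (forall w, act e w = m * w) -> act (wexp e n) v = m ^+ n * v.
Proof.
by move=> em; elim: n => [|n IHn] /=; rewrite ?mul1r // IHn em exprS mulrA.
Qed.

Lemma act_wU v : act wU v = upoly _ * v.
Proof.
rewrite /wU [LHS]/= (@act_wexp WT 'X) //.
by rewrite /upoly !mulrDl mul1r addrA.
Qed.

Lemma upoly_neq0 (k : nzRingType) : upoly k != 0.
Proof.
apply/eqP => /polyP/(_ 0%N); rewrite !coefE /=.
have := prime_gt1 p_pr; case: (p) => [|[|q]] //= _; rewrite !addr0 => /eqP.
by rewrite oner_eq0.
Qed.

Lemma deriv_expp (v : M) : (v ^+ p)^`() = 0.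
Proof.
rewrite deriv_exp -mulr_natr.
suff -> : p%:R = 0 :> M by rewrite mulr0.
by rewrite -(rmorph_nat (polyC \o polyC)) /= (pcharf0 pF).
Qed.

Lemma quasi_unit_power_of n : power_of wU n -> quasi_unit n.
Proof.
elim=> [||a b _ IHa _ IHb]; [exact: quasi_unit1 | | exact: quasi_unitM].
exists (fun v => upoly _ ^+ p.-1 * v), (upoly _ ^+ p).
split; [exact: deriv_expp | by rewrite expf_neq0 // upoly_neq0 | move=> v].
by rewrite act_wU mulrA -exprS prednK // prime_gt0.
Qed.

(** * Classes of exponents modulo p at z = 0 *)

Definition at0 : M -> {poly F} := map_poly (horner_eval 0).

Definition hits (k : F) (w : {poly F}) := exists2 j, w`_j != 0 & j%:R = k.
Definition pure (k : F) (w : {poly F}) :=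
  w != 0 /\ forall j, w`_j != 0 -> j%:R = k.

Lemma pure_hits k w : pure k w -> hits k w.
Proof.
by case=> w0 wk; exists (size w).-1; rewrite ?wk // -/(lead_coef w) lead_coef_eq0.
Qed.

Lemma hits_mul k l u w : hits l u -> pure k w -> hits (l + k) (u * w).
Proof.
case=> i ui il [w0 wk].
(* [ul] is the part of u in class l. As w lies in class k, [ul * w] is the part of [u * w] in class
   l + k, and it is nonzero in the domain F_p[X]. *)
pose ul := \poly_(j < size u) (if j%:R == l then u`_j else 0).
have ulE j : ul`_j = if j%:R == l then u`_j else 0.
  by rewrite coef_poly; case: ltnP => // le_j; rewrite nth_default // if_same.
have ul0 : ul != 0.
  by apply: contraNneq ui => ul0; have := ulE i; rewrite ul0 coef0 il eqxx => <-.
have ulw0 : ul * w != 0 by rewrite mulf_neq0.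
have lead0 : (ul * w)`_(size (ul * w)).-1 != 0.
  by rewrite -/(lead_coef _) lead_coef_eq0.
set n := _.-1 in lead0.
have nk : n%:R = l + k.
  apply/eqP; apply: contraNT lead0 => nlk; rewrite coefM big1 // => -[j /= le_j] _.
  rewrite ulE; case: eqP => [jl|]; last by rewrite mul0r.
  have [->|/wk wj] := eqVneq w`_(n - j) 0; first by rewrite mulr0.
  by case/eqP: nlk; rewrite -jl -wj -natrD subnKC.
exists n => //; suff -> : (u * w)`_n = (ul * w)`_n by [].
rewrite !coefM; apply: eq_bigr => -[j /= le_j] _; rewrite ulE.
case: eqP => // njl; have [->|/wk wj] := eqVneq w`_(n - j) 0; first by rewrite !mulr0.
by case: njl; apply: (addIr k); rewrite -nk -wj -natrD subnKC.
Qed.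

(** The exponents 0, 1 and 2p - 1 are distinct even for p = 2, so no coefficients cancel. *)
Lemma hits_upoly : [/\ hits 0 (upoly F), hits 1 (upoly F) & hits (-1) (upoly F)].
Proof.
have p1 := prime_gt1 p_pr.
have uE j : (upoly F)`_j = (j == 0%N)%:R + (j == 1%N)%:R + (j == (2 * p).-1)%:R.
  by rewrite /upoly !coefE.
split.
- exists 0%N => //; rewrite uE /=; have -> : (0 == (2 * p).-1)%N = false by lia.
  by rewrite !addr0 oner_neq0.
- exists 1%N => //; rewrite uE /=; have -> : (1 == (2 * p).-1)%N = false by lia.
  by rewrite add0r addr0 oner_neq0.
- exists (2 * p).-1.
    rewrite uE eqxx; have -> : ((2 * p).-1 == 0)%N = false by lia.
    have -> : ((2 * p).-1 == 1)%N = false by lia.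
    by rewrite !add0r oner_neq0.
  by rewrite -subn1 natrB ?natrM ?(pcharf0 pF) ?mulr0 ?sub0r //; lia.
Qed.

Lemma hits_upolyX k : hits k (upoly F ^+ p.-1).
Proof.
have p1 := prime_gt1 p_pr.
have [w ->] : exists w, upoly F ^+ p.-1 = (1 + 'X) ^+ p.-1 + w * 'X^p.
  rewrite /upoly; elim: (p.-1) => [|n [w IHn]].
    by exists 0; rewrite !expr0 mul0r addr0.
  exists ((1 + 'X) ^+ n * 'X^(p.-1) + w * (1 + 'X + 'X^((2 * p).-1))).
  rewrite exprSr IHn [(1 + 'X) ^+ n.+1]exprSr.
  have -> : 'X^((2 * p).-1) = 'X^(p.-1) * 'X^p :> {poly F} by rewrite -exprD; congr ('X^_); lia.
  by ring.
have lt_k : (val k < p)%N.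
  by have := ltn_ord k; rewrite [X in (_ < X)%N](Fp_cast p_pr).
exists (val k); last by rewrite natr_Zp.
rewrite coefD coefMXn lt_k addr0 addrC exprD1n prednK 1?ltnW //.
under eq_bigr => i _ do rewrite -scaler_nat.
rewrite -(poly_def p (fun i => ('C(p.-1, i))%:R)) coef_poly lt_k natF_eq0.
have le_k : (val k <= p.-1)%N by rewrite -ltnS prednK // ltnW.
(* The prime p does not divide (p - 1)!, hence not the binomial coefficient either. *)
have fact_ndiv m : (m < p)%N -> ~~ (p %| m`!)%N.
  elim: m => [|m IHm] lt_m; first by rewrite dvdn1 neq_ltn p1 orbT.
  rewrite factS Euclid_dvdM // negb_or IHm ?(ltnW lt_m) // andbT.
  by rewrite gtnNdvd.
apply: contra (fact_ndiv p.-1 _); last by rewrite prednK // ltnW.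
by move=> dv; rewrite -(bin_fact le_k) dvdn_mulr.
Qed.
End ModP.

(** * Reduced words followed modulo p *)

Section PingPong.
Variable p : nat.
Hypothesis p_pr : prime p.
Local Notation F := 'F_p.
Local Notation M := {poly {poly 'F_p}}.
Local Notation act := (@wact 'F_p).
Variables (D : divisionRingType) (y t : D).
Hypothesis ty : t * y = (y + 1) * t.
Local Notation ev := (weval y t).
Hypothesis ev_faithful : forall e1 e2, ev e1 = ev e2 -> act e1 =1 act e2.

(** The root of the denominator of a letter of sign e; the numerator has the other root. So [false]
    gives Y (Y - 1)^-1 and [true] its inverse. *)
Definition root_of (e : bool) : int := if e then 0 else 1.
(* At z = 0 this acts as a nonzero multiple of the projection onto the monomials
   X^i with i = - root_of e modulo p. *)
Definition wproj (e : bool) := WMul (wlin (root_of (~~ e))) (wprod (others p (root_of e))).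

Lemma act_wproj e (v : M) :
  act (wproj e) (act (wlin (root_of e)) v) =
  (norm_poly p)%:P * act (wlin (root_of (~~ e))) v.
Proof.
rewrite -[LHS]/(act (wlin _) (act (wprod _) (act (wlin _) v))) act_others_lin //.
by rewrite wactZ ?derivC.
Qed.

(** At z = 0 the factor a = - j kills X^j unless j is - [root_of e] modulo p. For such j the product
    over a is nonzero and the remaining factor is 1 or -1. *)
Lemma wproj_pure e (v : M) :
  hits (- (root_of e)%:~R) (at0 v) -> pure (- (root_of e)%:~R) (at0 (act (wproj e) v)).
Proof.
have coefE j : (at0 (act (wproj e) v))`_j =
    - (j%:R + (root_of (~~ e))%:~R) *
    \prod_(a : F | a != (root_of e)%:~R) - (j%:R + a) * (at0 v)`_j.
  rewrite coef_map -[act _ v]/(act (wlin _) (act (wprod _) v)) coef_wlin coef_wprod coef_map.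
  rewrite (prod_others _ (fun a => 'X - (j%:R + a)%:P)) /= /horner_eval.
  rewrite !hornerM.
  rewrite hornerXsubC sub0r horner_prod mulrA; congr (_ * _ * _).
  by apply: eq_bigr => a _; rewrite hornerXsubC sub0r.
have cE j : (at0 (act (wproj e) v))`_j != 0 -> j%:R = - (root_of e)%:~R :> F.
  rewrite coefE !mulf_eq0 !negb_or => /andP[/andP[_ /prodf_neq0 nz] _].
  apply/eqP; apply: contraT => jr.
  have := nz (- j%:R); rewrite subrr oppr0 eqxx; apply.
  by apply: contra jr => /eqP <-; rewrite opprK.
case=> j vj jr; split=> //.
suff : (at0 (act (wproj e) v))`_j != 0 by apply: contraNneq => ->; rewrite coef0.
rewrite coefE !mulf_neq0 //.
  by rewrite oppr_eq0 jr; case: (e); rewrite /= ?oppr0 ?add0r ?addr0 ?oppr_eq0 oner_eq0.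
apply/prodf_neq0 => a ar; rewrite oppr_eq0 jr addrC subr_eq0 //.
Qed.

(* The reduction of z modulo p is k^-1 phi. *)
Definition tracked (z : D) (k : M) (phi : wexpr) := exists s a,
  [/\ quasi_unit p s, z * ev s = ev a & forall v, act phi (act s v) = k * act a v].

Definition ore_elt n := forall e, exists c d,
  quasi_unit p c /\ ev e * ev c = ev n * ev d.

Lemma tracked1 : tracked 1 1 (WC 1).
Proof.
exists (WC 1), (WC 1); split=> [||v]; [exact: quasi_unit1 | by rewrite mul1r | by rewrite mul1r].
Qed.

(** From z s = a and a c = n d follows m n^-1 z (s c) = m d. Modulo p, q stands for nu m n^-1, and
    the scalar k commutes with it. *)
Lemma tracked_step n m q nu z k phi :
    ev n != 0 -> ore_elt n -> (forall v, act q (act n v) = nu * act m v) ->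
    k^`() = 0 ->
  tracked z k phi -> tracked (ev m * (ev n)^-1 * z) (nu * k) (WMul q phi).
Proof.
move=> n0 on qn dk [s [a [qs zs sa]]]; have [c [d [qc acnd]]] := on a.
exists (WMul s c), (WMul m d); split=> [||v /=].
- exact: quasi_unitM.
- by rewrite /= !mulrA -(mulrA _ z) zs -mulrA acnd !mulrA divrK ?divring_unit.
- have := ev_faithful (e1 := WMul a c) (e2 := WMul n d) acnd v => /= acv.
  by rewrite sa wactZ // acv qn !mulrA (mulrC k).
Qed.

(** For z = 1 numerator and denominator act alike; composing with the quasi-inverse of s leaves a
    nonzero scalar, which cancels in the domain [M]. *)
Lemma tracked_one k phi :
  tracked 1 k phi -> forall v, act phi v = k * v.
Proof.
case=> s [a [[c [l [dl l0 sc]]] sa phis]] v.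
move: sa; rewrite mul1r => /ev_faithful sa.
by apply: (mulfI l0); rewrite -wactZ // -sc phis -sa sc mulrCA.
Qed.

Lemma ev_neq0 e : act e 1 != 0 -> ev e != 0.
Proof.
by apply: contraNneq => e0; rewrite (ev_faithful (e2 := WC 0)) ?mulr0z //= e0.
Qed.

Lemma ev_wlin_neq0 c : ev (wlin c) != 0.
Proof.
apply: ev_neq0; apply/eqP => act0; have := coef_wlin (p := p) c 1 0.
have -> : (1 : M)`_0 = 1 by rewrite -[1]/(1%:P) coefC.
rewrite act0 mulr1 [LHS]coef0 => /eqP.
by rewrite eq_sym polyXsubC_eq0.
Qed.

Lemma ev_wU_neq0 : ev (wU p) != 0.
Proof. by apply: ev_neq0; rewrite act_wU mulr1 upoly_neq0. Qed.

Lemma ore_wlin c : ore_elt (wlin c).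
Proof.
move=> e; have [b [d [Sb ebd]]] := ore_linear_product ty e (LPlin c).
by exists b, d; split=> //; apply: quasi_unit_linear_product.
Qed.

Lemma ore_one : ore_elt (WC 1).
Proof.
by move=> e; exists (WC 1), e; split; [exact: quasi_unit1 | rewrite /= mul1r mulr1].
Qed.

Lemma ore_wU : ore_elt (wU p).
Proof.
(* [B] is stable under sums and products and contains 1 and t, as y t - t y = - t; hence it contains
   the value of U. *)
pose B a := GRing.comm t a /\ GRing.comm t (y * a - a * y).
have BD a b : B a -> B b -> B (a + b).
  move=> [ta tya] [tb tyb]; split; first exact: commrD.
  by rewrite mulrDr mulrDl opprD addrACA; apply: commrD.
have BM a b : B a -> B b -> B (a * b).
  move=> [ta tya] [tb tyb]; split; first exact: commrM.
  have -> : y * (a * b) - a * b * y = (y * a - a * y) * b + a * (y * b - b * y).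
    by rewrite mulrBl mulrBr !mulrA addrA subrK.
  by apply: commrD; apply: commrM.
have B1 : B 1 by split; rewrite ?mulr1 ?mul1r ?subrr; [exact: commr1 | exact: commr0].
have Bt : B t.
  split; first exact: commr_refl.
  by rewrite ty mulrDl mul1r opprD addrA subrr add0r; apply: commrN; apply: commr_refl.
have BX n : B (t ^+ n) by elim: n => [|n IHn]; rewrite ?exprS; [exact: B1 | exact: BM].
have [tU tyU] : B (ev (wU p)).
  by rewrite /= weval_wexp /=; apply: (BD) => //; apply: BD.
have cent z : GRing.comm z t -> GRing.comm z (ev (wU p)).
  move=> zt; rewrite /= weval_wexp /=.
  by apply: commrD; [exact: commr1 | apply: commrD => //; apply: commrX].
move=> e; have [b [d [Sb ebd]]] :=
  ore_power_of (commr_sym tU) (commr_sym tyU) cent e (POu _).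
by exists b, d; split=> //; apply: quasi_unit_power_of.
Qed.

Definition conjugator (b : bool) : wexpr := if b then wU p else WC 1.

Definition gen_val (l : bool * bool) : D :=
  ev (conjugator l.1) *
    (ev (wlin (root_of (~~ l.2))) / ev (wlin (root_of l.2))) / ev (conjugator l.1).

Definition labels_reduced (w : seq (bool * bool)) :=
  sorted (fun l m => ~~ ((l.1 == m.1) && (l.2 != m.2))) w.

Lemma ev_conjugator_neq0 b : ev (conjugator b) != 0.
Proof. by case: b; [exact: ev_wU_neq0 | exact: oner_neq0]. Qed.

Lemma tracked_conj b z k phi : k^`() = 0 -> tracked z k phi ->
  tracked (ev (conjugator b) * z) k (WMul (conjugator b) phi).
Proof.
move=> dk zk; have := @tracked_step (WC 1) (conjugator b) (conjugator b) 1 z k phi.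
rewrite /= invr1 mulr1 mul1r; apply=> //; first exact: oner_neq0.
  exact: ore_one.
by move=> v; rewrite mul1r.
Qed.

(** Replaces the inverse of the conjugator: U U^(p-1) = U^p is a scalar because its derivative is
    0. *)
Definition conjugator_adj b := if b then wexp (wU p) p.-1 else WC 1.
Definition conjugator_norm b : M := if b then upoly p _ ^+ p else 1.

Lemma tracked_conjV b z k phi : k^`() = 0 -> tracked z k phi ->
  tracked ((ev (conjugator b))^-1 * z) (conjugator_norm b * k) (WMul (conjugator_adj b) phi).
Proof.
move=> dk zk.
have := @tracked_step (conjugator b) (WC 1) (conjugator_adj b) (conjugator_norm b) z k phi.
rewrite -[ev (WC 1)]/1 mul1r; apply=> //; first exact: ev_conjugator_neq0.
  by case: b; [exact: ore_wU | exact: ore_one].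
case: b => v; last by rewrite /= !mul1r.
rewrite /= -[X in act _ X]/(act (wU p) v) (act_wexp _ _ (act_wU (p := p))).
by rewrite act_wU mulrA -exprSr prednK ?prime_gt0.
Qed.

Lemma deriv_mul0 (k l : M) : k^`() = 0 -> l^`() = 0 -> (k * l)^`() = 0.
Proof. by move=> dk dl; rewrite derivM dk dl mul0r mulr0 addr0. Qed.

Lemma deriv_conjugator_norm b : (conjugator_norm b)^`() = 0.
Proof. by case: b; [exact: deriv_expp | exact: derivC]. Qed.

Lemma at0M (u v : M) : at0 (u * v) = at0 u * at0 v.
Proof. by rewrite /at0 rmorphM. Qed.

Lemma at0X (u : M) n : at0 (u ^+ n) = at0 u ^+ n.
Proof. by rewrite /at0 rmorphXn. Qed.

Lemma at0_upoly : at0 (upoly p _) = upoly p F.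
Proof. by rewrite /at0 /upoly !rmorphD rmorph1 !rmorphXn /= map_polyX. Qed.

Lemma root_diff e e' :
  let d := (root_of e')%:~R - (root_of e)%:~R : F in [\/ d = 0, d = 1 | d = -1].
Proof.
case: e; case: e' => /=; rewrite ?subrr ?subr0 ?sub0r.
- by constructor 1.
- by constructor 2.
- by constructor 3.
- by constructor 1.
Qed.

(** The two classes differ by 0, 1 or -1, and u has a monomial in each of these classes. *)
Lemma hits_shift u e e' w :
    [/\ hits 0 u, hits 1 u & hits (-1) u] ->
  pure (- (root_of e')%:~R) w -> hits (- (root_of e)%:~R : F) (u * w).
Proof.
move=> [u0 u1 um1] we'.
have -> : - (root_of e)%:~R = (root_of e')%:~R - (root_of e)%:~R - (root_of e')%:~R :> F.
  by ring.
by apply: hits_mul we'; case: (root_diff e e') => ->.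
Qed.

Lemma pure_Xn (j : nat) : pure (j%:R : F) 'X^j.
Proof.
split; first by rewrite monic_neq0 ?monicXn.
by move=> i; rewrite coefXn; have [-> //|_] := eqVneq i j; rewrite eqxx.
Qed.

(** Once its left conjugator is stripped, a letter contributes only a fraction in Y, at the cost of
    the scalar N, which vanishes at z = 0. *)
Lemma tracked_letter b e z k phi v :
    k^`() = 0 -> tracked ((ev (conjugator b))^-1 * z) k phi ->
    hits (- (root_of e)%:~R) (at0 (act phi v)) ->
  exists k' phi',
    [/\ k'^`() = 0, at0 k' = 0,
        tracked ((ev (conjugator b))^-1 * (gen_val (b, e) * z)) k' phi' &
        pure (- (root_of e)%:~R) (at0 (act phi' v))].
Proof.
move=> dk zk hv; exists ((norm_poly p)%:P * k), (WMul (wproj e) phi); split.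
- by apply: deriv_mul0; rewrite ?derivC.
- by rewrite at0M /at0 map_polyC /= /horner_eval norm_poly0 mul0r.
- rewrite /gen_val -!mulrA mulKr ?divring_unit ?ev_conjugator_neq0 // mulrA.
  exact: (tracked_step (ev_wlin_neq0 _) (@ore_wlin _) (@act_wproj e) dk zk).
- exact: wproj_pure.
Qed.

(* Inside a block of equal generators reducedness keeps the sign, hence the
   class onto which [wproj] projects; across blocks the conjugating element
   mixes the classes. *)
Lemma tracked_word w b e : labels_reduced ((b, e) :: w) ->
  exists k phi v,
    [/\ k^`() = 0, at0 k = 0,
        tracked ((ev (conjugator b))^-1 * \prod_(l <- (b, e) :: w) gen_val l) k phi &
        pure (- (root_of e)%:~R) (at0 (act phi v))].
Proof.
have hit_adj e1 e2 (v : M) : pure (- (root_of e1)%:~R) (at0 v) ->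
    hits (- (root_of e2)%:~R) (at0 (act (conjugator_adj true) v)).
  rewrite (act_wexp _ _ (act_wU (p := p))) at0M at0X at0_upoly.
  by apply: hits_shift; split; apply: hits_upolyX.
elim: w b e => [|[b' e'] w IHw] b e red_w; rewrite big_cons.
  rewrite big_nil; pose j := if e then 0%N else p.-1.
  have jE : j%:R = - (root_of e)%:~R :> F.
    rewrite /j; case: (e); first by rewrite oppr0.
    by rewrite -subn1 natrB ?prime_gt0 // pchar_Fp_0 // sub0r.
  have pj : pure (- (root_of e)%:~R) (at0 ('X^j : M)).
    by rewrite at0X /at0 map_polyX -jE; apply: pure_Xn.
  have tr1 := tracked_conjV b (derivC 1) tracked1.
  have d1 : (conjugator_norm b * 1)^`() = 0 by rewrite mulr1 deriv_conjugator_norm.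
  have [|k2 [phi2 ?]] := tracked_letter (v := 'X^j) (e := e) d1 tr1; last by exists k2, phi2, 'X^j.
  by case: (b); [exact: hit_adj pj | exact: pure_hits].
have [k [phi [v [dk k0 zk pv]]]] := IHw b' e' (path_sorted red_w).
have /= /andP[red_l _] := red_w.
move: (\prod_(l <- _) _) zk => z zk.
suff [k1 [phi1 [dk1 zk1 hv1]]] : exists k1 phi1, [/\ k1^`() = 0,
    tracked ((ev (conjugator b))^-1 * z) k1 phi1 &
    hits (- (root_of e)%:~R) (at0 (act phi1 v))].
  by have [k2 [phi2 ?]] := tracked_letter dk1 zk1 hv1; exists k2, phi2, v.
case: b b' red_l zk {red_w} => [] [] red_l zk.
- by exists k, phi; split=> //; move: red_l; rewrite negbK => /eqP ->; apply: pure_hits.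
(* Here [b] is [true] and [b'] is [false], so U^-1 is put in front; in the next case the stripped U
   is restored. *)
- exists (conjugator_norm true * k), (WMul (conjugator_adj true) phi); split.
  + by rewrite deriv_mul0 // deriv_conjugator_norm.
  + by have := tracked_conjV true dk zk; rewrite /= invr1 mul1r.
  + exact: hit_adj pv.
- exists k, (WMul (conjugator true) phi); split=> //.
    by have := tracked_conj true dk zk; rewrite mulVKr ?divring_unit ?ev_wU_neq0 //= invr1 mul1r.
  rewrite -[act _ v]/(act (wU p) (act phi v)) act_wU at0M at0_upoly.
  by apply: hits_shift pv; apply: hits_upoly.
- by exists k, phi; split=> //; move: red_l; rewrite negbK => /eqP ->; apply: pure_hits.
Qed.

(** If the word were 1, phi with its conjugator restored would act as k, which is 0 at z = 0; but
    there phi v and U are both nonzero. *)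
Lemma gen_word_neq1 w : labels_reduced w -> w != [::] ->
  \prod_(l <- w) gen_val l != 1.
Proof.
case: w => // -[b e] w red_w _; apply/eqP => w1.
have [k [phi [v [dk k0 zk [pv _]]]]] := tracked_word red_w.
have := tracked_conj b dk zk; rewrite w1 mulr1 divrr ?divring_unit ?ev_conjugator_neq0 //.
move/tracked_one/(_ v)/(congr1 (@at0 p)); rewrite at0M k0 mul0r; apply/eqP.
case: (b); last exact: pv.
by rewrite -[act _ v]/(act (wU p) (act phi v)) act_wU at0M at0_upoly mulf_neq0 ?upoly_neq0.
Qed.

Lemma gen_val_neq0 l : gen_val l != 0.
Proof.
have U e : ev e != 0 -> ev e \is a GRing.unit by apply: divring_unit.
have nz (z : D) : z \is a GRing.unit -> z != 0 by apply: contraTneq => ->; rewrite unitr0.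
have [UY UC] := (fun c => U _ (ev_wlin_neq0 c), fun b => U _ (ev_conjugator_neq0 b)).
by apply: nz; rewrite /gen_val !unitrMr ?unitrV ?UY ?UC.
Qed.

Lemma gen_valV b e : gen_val (b, ~~ e) = (gen_val (b, e))^-1.
Proof.
have UY c := divring_unit _ (ev_wlin_neq0 c).
have UC := divring_unit _ (ev_conjugator_neq0 b).
rewrite /gen_val /= negbK !invrM ?unitrMr ?unitrV ?UY ?UC // !invrK mulrA.
by rewrite !mulrA.
Qed.

End PingPong.

(** * Words in a group and free pairs *)

Section FreeGroup.
Variable G : groupType.
Local Open Scope group_scope.

Lemma word_val_cat (w1 w2 : seq (G * bool)) :
  word_val (w1 ++ w2) = word_val w1 * word_val w2.
Proof. by rewrite /word_val big_cat. Qed.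

Definition word_inv (w : seq (G * bool)) := rev [seq (l.1, ~~ l.2) | l <- w].

Lemma word_val_inv w : word_val (word_inv w) = (word_val w)^-1.
Proof.
rewrite /word_inv; elim: w => [|[x e] w IHw]; first by rewrite /word_val !big_nil invg1.
rewrite /= rev_cons -cats1 word_val_cat IHw /word_val big_seq1 big_cons invgM.
by congr (_ * _); case: e; rewrite /letter_val /= ?invgK.
Qed.

Lemma generated_subgroup (X : G -> Prop) :
  is_subgroup (fun h => exists2 w, word_over X w & h = word_val w).
Proof.
split.
- by exists [::]; rewrite ?/word_val ?big_nil.
- move=> x y [w1 X1 ->] [w2 X2 ->]; exists (w1 ++ w2); last by rewrite word_val_cat.
  by move=> l; rewrite mem_cat => /orP[/X1|/X2].
- move=> x [w Xw ->]; exists (word_inv w); last by rewrite word_val_inv.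
  by move=> l; rewrite mem_rev => /mapP[m /Xw Xm ->].
Qed.

(** The hypothesis makes g injective, so words over its image come from words of labels. In a cyclic
    group the two generators would commute, but their commutator is a nonempty reduced word. *)
Lemma free_pair_subgroup (g : bool -> G) :
    (forall w : seq (bool * bool), labels_reduced w ->
       word_val [seq (g l.1, l.2) | l <- w] = 1 -> w = [::]) ->
  exists H : G -> Prop, [/\ is_subgroup H, is_free H & ~ is_cyclic H].
Proof.
move=> free_g.
have g_neq : g false != g true.
  apply/eqP => gft; have := free_g [:: (false, false); (true, true)] isT.
  by rewrite /word_val !big_cons big_nil /letter_val /= gft mulg1 mulgV => /(_ erefl).
have g_inj : injective g.
  by case=> [] [] // gE; move: g_neq; rewrite gE eqxx.
pose X z := exists b, z = g b.
pose H h := exists2 w, word_over X w & h = word_val w.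
exists H; split; first exact: generated_subgroup.
  exists X; split=> // w Xw red_w w1.
  pose lab (l : G * bool) := (l.1 == g true, l.2).
  have labK l : l \in w -> (g (lab l).1, (lab l).2) = l.
    move=> /Xw; case: l => [z e] /= [b ->]; rewrite (inj_eq g_inj).
    by case: b.
  have mapK : [seq (g l.1, l.2) | l <- [seq lab l | l <- w]] = w.
    by rewrite -map_comp -[RHS]map_id; apply/eq_in_map => l /labK.
  have : [seq lab l | l <- w] = [::].
    apply: free_g; last by rewrite mapK.
    move: red_w; rewrite -{1}mapK /reduced /labels_reduced sorted_map.
    by apply: sub_sorted => l m /=; rewrite (inj_eq g_inj).
  by case: (w).
case=> c cyc; have Hg b : H (g b).
  exists [:: (g b, false)]; last by rewrite /word_val big_seq1.
  by move=> l; rewrite inE => /eqP ->; exists b.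
have comm_c z : H z -> commute c z.
  move/cyc => [n [->|->]]; first exact: commuteX.
  by apply: commuteV; apply: commuteX.
have gg : g false * g true = g true * g false.
  have /comm_c cf := Hg false; have /cyc [n [->|->]] := Hg true.
    exact/commuteX/commute_sym.
  exact/commuteV/commuteX/commute_sym.
have := free_g [:: (false, false); (true, false); (false, true); (true, true)] isT.
rewrite /word_val !big_cons big_nil /letter_val /= mulg1 mulgA gg.
by rewrite -invgM mulgV => /(_ erefl).
Qed.

End FreeGroup.

Theorem mainTheorem6 (K : fieldType) (delta : derivation K)
    (hdelta : exists a : K, delta a != 0)
    (D : divisionRingType) (f : {rmorphism diffpoly delta -> D})
    (hD : is_quotient_division_ring f) :
  exists H : nonzero D -> Prop, [/\ is_subgroup H, is_free H & ~ is_cyclic H].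
Proof.
have [x dx0] := hdelta; have [f_inj _] := hD.
have [p p_pr redp] := prime_reduction_ex K.
pose y := f (weylY delta x); pose t := f (weylT delta x).
have ty : t * y = (y + 1) * t.
  by rewrite /t /y -rmorphM /= weyl_comm // rmorphM rmorphD rmorph1.
have faithful e1 e2 := @wact_faithful K delta x p D f e1 e2 dx0 f_inj redp.
(* [g false] is Y (Y - 1)^-1 and [g true] is its conjugate by U. *)
pose g b : nonzero D := Sub (gen_val p y t (b, false)) (gen_val_neq0 p_pr faithful (b, false)).
apply: (@free_pair_subgroup _ g) => w red_w.
have letterE l : val (letter_val (g l.1, l.2)) = gen_val p y t l.
  case: l => b [] //.
  by rewrite -[true]/(~~ false) (gen_valV p_pr faithful).
have wordE : val (word_val [seq (g l.1, l.2) | l <- w]) = \prod_(l <- w) gen_val p y t l.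
  elim: (w) => [|l s IHs]; first by rewrite /word_val !big_nil.
  by rewrite /word_val /= !big_cons -letterE -IHs.
move=> /(congr1 val); rewrite wordE => w1.
apply/eqP; apply: contraTT isT => w_neq0.
by have := gen_word_neq1 p_pr ty faithful red_w w_neq0; rewrite w1 eqxx.
Qed.
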